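(* Let $(N,R)$ be an instance of the minimum Steiner tree problem with $r\in R$, and let $h^*$ be a consistent Steiner heuristic function. Then $h^*$ is admissible.
   Context: A network is $N=(V,E,\sigma)$ where $(V,E)$ is a connected undirected graph and $\sigma:E\to\{1,2,3,\dots\}$ gives edge costs. An instance of the minimum Steiner tree problem is a pair $(N,R)$ with $\emptyset\ne R\subseteq V$ (the terminals). For a nonempty set $S\subseteq V$, a Steiner tree for $(N,S)$ is a tree $(V',E')$ with $S\subseteq V'\subseteq V$ and $E'\subseteq E$; its cost is $\sum_{e\in E'}\sigma(e)$, and $\mathrm{csmt}(N,S)$ denotes the minimum cost of a Steiner tree for $(N,S)$. For $u\in V$ and $I\subseteq V$, put $l^*(u,I):=\mathrm{csmt}(N,I\cup\{u\})$. A Steiner heuristic function is a map $h^*$ from $V\times 2^R$ to the non-negative integers. With respect to the fixed terminal $r\in R$, it is - admissible if $h^*(u,I)\le l^*(u,I)$ for every $u\in V$ and every $I$ with $\{r\}\subseteq I\subseteq R$; - consistent if $h^*(u,I)\le h^*(v,I')+l^*(v,(I\setminus I')\cup\{u\})$ for all $u,v\in V$ and all $I',I$ with $\{r\}\subseteq I'\subseteq I\subseteq R$.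
   Formalization: The formal theorem additionally assumes h*(r,{r}) = 0; without it the claim is false (the constant function 5 is consistent but not admissible, since l*(r,{r}) = 0), and every admissible h* satisfies it. *)

(* Defs.v *)
From mathcomp Require Import all_boot.
Set Implicit Arguments.
Unset Strict Implicit.
Unset Printing Implicit Defensive.

(* An undirected graph on V is given by its set F of edges,
   each edge being a two-element set of vertices. *)
Definition adj (V : finType) (F : {set {set V}}) : rel V :=
  fun x y => [set x; y] \in F.

(* The values of [sigma] outside [edges] are irrelevant. *)
Record network (V : finType) := Network {
  edges : {set {set V}};
  sigma : {set V} -> nat;
  edges_card : forall e, e \in edges -> #|e| = 2;
  edges_connected : forall x y, connect (adj edges) x y;
  sigma_gt0 : forall e, e \in edges -> 0 < sigma e
}.

(* A duplicate-free closed walk with at most two vertices traverses a single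
   edge back and forth, hence is not a cycle of the graph. The bounds on the
   length make this a boolean; [acyclicP] removes them. *)
Definition acyclic (V : finType) (F : {set {set V}}) : bool :=
  [forall n : 'I_#|V|.+1, [forall p : n.-tuple V,
     ucycleb (adj F) p ==> (size p <= 2)]].

Definition is_tree (V : finType) (W : {set V}) (F : {set {set V}}) : bool :=
  [&& W != set0,
      [forall (e | e \in F), e \subset W],
      [forall (x | x \in W), [forall (y | y \in W), connect (adj F) x y]]
    & acyclic F].

Definition steiner_tree (V : finType) (N : network V) (S : {set V})
    (T : {set V} * {set {set V}}) : bool :=
  [&& S \subset T.1, T.2 \subset edges N & is_tree T.1 T.2].

Definition tree_cost (V : finType) (N : network V)
    (T : {set V} * {set {set V}}) : nat :=
  \sum_(e in T.2) sigma N e.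

(* The pair [(set0, set0)] is only a default, returned when there is no Steiner
   tree; by [csmtP] it plays no role for nonempty S. *)
Definition csmt (V : finType) (N : network V) (S : {set V}) : nat :=
  tree_cost N [arg min_(T < (set0, set0) | steiner_tree N S T) tree_cost N T].

Definition lstar (V : finType) (N : network V) (u : V) (I : {set V}) : nat :=
  csmt N (u |: I).

(* A function on V x 2^R is represented by a function on all pairs of a vertex
   and a set of vertices; only its values at subsets of R are constrained. *)
Definition admissible (V : finType) (N : network V) (R : {set V}) (r : V)
    (h : V -> {set V} -> nat) : Prop :=
  forall (u : V) (I : {set V}),
    [set r] \subset I -> I \subset R -> h u I <= lstar N u I.

(* Adding a constant to h preserves this condition, so it bounds h only relative
   to h r [set r]; any admissible h has h r [set r] = 0, since
   lstar N r [set r] = 0. The normalization h r [set r] = 0 is not included. *)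
Definition consistent (V : finType) (N : network V) (R : {set V}) (r : V)
    (h : V -> {set V} -> nat) : Prop :=
  forall (u v : V) (I' I : {set V}),
    [set r] \subset I' -> I' \subset I -> I \subset R ->
    h u I <= h v I' + lstar N v (u |: (I :\: I')).

Lemma adj_sym (V : finType) (F : {set {set V}}) : symmetric (adj F).
Proof. by move=> x y; rewrite /adj setUC. Qed.

Lemma acyclicP (V : finType) (F : {set {set V}}) :
  reflect (forall p, ucycle (adj F) p -> size p <= 2) (acyclic F).
Proof.
apply: (iffP forallP) => [acF p cp | acF n].
  have ltp : size p < #|V|.+1.
    by rewrite ltnS -(card_uniqP (proj2 (andP cp))) max_card.
  by have /forallP/(_ (in_tuple p))/implyP := acF (Ordinal ltp); apply.
by apply/forallP => p; apply/implyP; apply: acF.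
Qed.

Lemma steiner_tree_exists (V : finType) (N : network V) (S : {set V}) :
  S != set0 -> exists T, steiner_tree N S T.
Proof.
case/set0Pn=> s _.
pose conn (F : {set {set V}}) := [forall x, forall y, connect (adj F) x y].
have connE : conn (edges N).
  by apply/forallP => x; apply/forallP => y; apply: edges_connected.
have [F /minsetP[connF minF] subF] := minset_exists connE.
exists (setT, F); rewrite /steiner_tree subsetT subF /is_tree /=.
apply/and4P; split; first by apply/set0Pn; exists s.
- by apply/forall_inP => e _; apply: subsetT.
- apply/forall_inP => x _; apply/forall_inP => y _.
  by have /forallP/(_ x)/forallP/(_ y) := connF.
apply/acyclicP => -[|x [|y q]] // /andP[cF uF].
case/lastP: q cF uF => [|q z] // cF uF.
have /and3P[xy yq zx] : [&& adj F x y, path (adj F) y (rcons q z) & adj F z x].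
  by move: cF; rewrite /= rcons_path last_rcons.
have /and3P[xNq yNq _] : [&& x \notin y :: rcons q z, y \notin rcons q z & true].
  by move: uF; rewrite !cons_uniq => /and3P[-> ->].
pose F' := F :\ [set x; y].
have keep a b : a != x -> adj F a b -> b != x -> adj F' a b.
  move=> ax ab bx; rewrite /adj !inE -/(adj F a b) ab andbT.
  apply: contraTneq (set21 x y) => <-.
  by rewrite !inE negb_or ![x == _]eq_sym ax bx.
have yz : connect (adj F') y z.
  apply/connectP; exists (rcons q z); last by rewrite last_rcons.
  apply: (sub_in_path (P := predC1 x) _ _ yq) => [a b ax bx ab|].
    exact: keep.
  by apply/allP => w wq; apply: contraNneq xNq => <-.
have zx' : connect (adj F') z x.
  apply: connect1; rewrite /adj !inE -/(adj F z x) zx andbT.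
  apply: contraNneq yNq => E; have := set22 x y; rewrite -E !inE.
  case/orP=> /eqP yE; first by rewrite yE mem_rcons mem_head.
  by move: xNq; rewrite -yE mem_head.
have yx : connect (adj F') y x := connect_trans yz zx'.
have connF' : conn F'.
  apply/forallP => a; apply/forallP => b.
  have /forallP/(_ a)/forallP/(_ b) := connF.
  apply: connect_sub a b => a b ab.
  have [E|nE] := eqVneq [set a; b] [set x; y]; last first.
    by apply: connect1; rewrite /adj !inE nE.
  have /set2P ha : a \in [set x; y] by rewrite -E set21.
  have /set2P hb : b \in [set x; y] by rewrite -E set22.
  have xy' : connect (adj F') x y by rewrite (sym_connect_sym (@adj_sym _ F')).
  by case: ha hb => -> [] ->.
have := minF _ connF' (subD1set _ _) => /setP/(_ [set x; y]).
by rewrite !inE eqxx (_ : [set x; y] \in F).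
Qed.

Lemma csmtP (V : finType) (N : network V) (S : {set V}) : S != set0 ->
  (exists2 T, steiner_tree N S T & csmt N S = tree_cost N T) /\
  (forall T, steiner_tree N S T -> csmt N S <= tree_cost N T).
Proof.
move=> /(steiner_tree_exists N) [T0 T0P].
have -> : csmt N S =
    tree_cost N [arg min_(T < T0 | steiner_tree N S T) tree_cost N T].
  rewrite /csmt; congr (tree_cost N _).
  rewrite /arg_min /extremum; case: pickP => // none.
  have [T TP Tmin] := arg_minnP (tree_cost N) T0P.
  have /= := none T; rewrite TP => /negbT/forallP[] T'.
  by apply/implyP; apply: Tmin.
by case: arg_minnP => // T TP Tmin; split=> //; exists T.
Qed.

(* Main.v *)
Require Import Defs.
From mathcomp Require Import all_boot.

(** Comparing [(u, I)] with the root state [(r, [set r])], where [h] vanishes by [h_root], leaves in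
    the consistency bound only a minimum Steiner tree cost, and its terminal set is exactly that of
    [lstar N u I]. *)

Theorem proposition7 (V : finType) (N : network V) (R : {set V}) (r : V)
    (h : V -> {set V} -> nat) (hR : R != set0) (hr : r \in R)
    (h_root : h r [set r] = 0) (hcons : consistent N R r h) :
  admissible N R r h.
Proof.
move=> u I rI IR.
have := hcons u r [set r] I (subxx _) rI IR.
(* The terminal set [r |: (u |: (I :\ r))] regroups to [u |: I], because [r] lies in [I]. *)
rewrite h_root add0n /lstar setUCA setD1K //.
by rewrite -sub1set.
Qed.
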